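(* Let $\pi^{\blacktriangle}\stackrel{def}{=}\{\mathbf{y}=\mathbf{x}\otimes\mathbf{x}^{\blacktriangle}\mid\mathbf{x}\in\mathbb{W}\}$ be a plane defined with the triple of points $(\Lambda,\mathbf{1},\Theta)$, where $\Theta\stackrel{def}{=}\theta/\sqrt{2}$ is a squeezed vector $\theta$. Let the plane $\pi^{\blacktriangle}$ be equipped with the operation $\boxtimes$ which is the reduction (restriction) of the operation $\otimes$ from the whole space $\mathbb{W}$ to its subplane $\pi^{\blacktriangle}$. Then the operation $\boxtimes$ is defined on the plane $\pi^{\blacktriangle}$ by the table $$\begin{array}{c|cc}\boxtimes&\mathbf{1}&\Theta\\ \hline \mathbf{1}&\mathbf{1}&\Theta\\ \Theta&\Theta&\mathbf{1}\end{array}$$ and the plane $\pi^{\blacktriangle}$ is isomorphic to the hyperbolic (Clifford) complex plane with the ''real unit'' $\mathbf{1}$ and the ''imaginary unit'' $\Theta$, respectively.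
   Context: $\mathbb{W}$ is the real algebra whose underlying space is the Euclidean vector space $\mathbb{E}_4=\mathbb{R}^4$ with standard addition $\oplus$ (subtraction is denoted $\ominus$) and scalar multiplication, zero vector $\Lambda=(0,0,0,0)$, standard basis $\mathbf{1}=(1,0,0,0)$, $\mathbf{i}=(0,1,0,0)$, $\mathbf{j}=(0,0,1,0)$, $\mathbf{k}=(0,0,0,1)$, and multiplication, for $\mathbf{x}=(X_{\mathbf{1}},X_{\mathbf{i}},X_{\mathbf{j}},X_{\mathbf{k}})$ and $\mathbf{y}=(Y_{\mathbf{1}},Y_{\mathbf{i}},Y_{\mathbf{j}},Y_{\mathbf{k}})$, $$\mathbf{x}\otimes\mathbf{y}=(X_{\mathbf{1}}Y_{\mathbf{1}}-X_{\mathbf{i}}Y_{\mathbf{k}}-X_{\mathbf{j}}Y_{\mathbf{j}}-X_{\mathbf{k}}Y_{\mathbf{i}})\,\mathbf{1}\oplus(X_{\mathbf{1}}Y_{\mathbf{i}}+X_{\mathbf{i}}Y_{\mathbf{1}}-X_{\mathbf{j}}Y_{\mathbf{k}}-X_{\mathbf{k}}Y_{\mathbf{j}})\,\mathbf{i}\oplus(X_{\mathbf{1}}Y_{\mathbf{j}}+X_{\mathbf{i}}Y_{\mathbf{i}}+X_{\mathbf{j}}Y_{\mathbf{1}}-X_{\mathbf{k}}Y_{\mathbf{k}})\,\mathbf{j}\oplus(X_{\mathbf{1}}Y_{\mathbf{k}}+X_{\mathbf{i}}Y_{\mathbf{j}}+X_{\mathbf{j}}Y_{\mathbf{i}}+X_{\mathbf{k}}Y_{\mathbf{1}})\,\mathbf{k}.$$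 For $\mathbf{x}=X_{\mathbf{1}}\mathbf{1}\oplus X_{\mathbf{i}}\mathbf{i}\oplus X_{\mathbf{j}}\mathbf{j}\oplus X_{\mathbf{k}}\mathbf{k}\in\mathbb{W}$, the $\blacktriangle$-conjugate is $\mathbf{x}^{\blacktriangle}=X_{\mathbf{1}}\mathbf{1}\ominus X_{\mathbf{k}}\mathbf{i}\ominus X_{\mathbf{j}}\mathbf{j}\ominus X_{\mathbf{i}}\mathbf{k}$. The vector $\theta$ is $\theta=\mathbf{i}\ominus\mathbf{k}=(0,1,0,-1)$. The hyperbolic (Clifford) complex plane is the real algebra $\{a+bh: a,b\in\mathbb{R}\}$ with real unit $1$ and imaginary unit $h$ satisfying $h^2=1$.
   Formalization: The set of all x⊗x^▲ is not a plane (its 1-coordinate is a sum of squares, so −1 is never attained); π^▲ is taken to be the linear span of this set, which is proved to be the plane through (Λ, 1, Θ). *)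

(* Defs.v *)
From HB Require Import structures.
From mathcomp Require Import all_boot all_order all_algebra.
From mathcomp Require Import boolp classical_sets reals.
From mathcomp Require Import ring.

Set Implicit Arguments.
Unset Strict Implicit.
Unset Printing Implicit Defensive.

Import Order.TTheory GRing.Theory Num.Theory.
Local Open Scope classical_set_scope.
Local Open Scope ring_scope.

Section LinearHull.
Variables (K : fieldType) (V : vectType K).

Lemma linear_hull_subproof (S : set V) :
  {U : {vspace V} | (forall v, S v -> v \in U) /\
    (forall U' : {vspace V}, (forall v, S v -> v \in U') -> (U <= U')%VS)}.
Proof.
apply: cid.
pose P n := `[< exists2 X : seq V, (forall v, v \in X -> S v) &
                                   \dim <<X>> = n >].
have Pex : exists n, P n.
  by exists 0%N; apply/asboolP; exists [::]; rewrite // span_nil dimv0.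
have Pub n : P n -> (n <= \dim {:V})%N.
  by move=> /asboolP[X _ <-]; apply: dimvS; apply: subvf.
case: (ex_maxnP Pex Pub) => n /asboolP[X SX dimX] maxn.
exists <<X>>%VS; split=> [v Sv|U' SU'].
  have sub : (<<X>> <= <<v :: X>>)%VS.
    by apply: sub_span => u uX; rewrite in_cons uX orbT.
  suff <- : <<v :: X>>%VS = <<X>>%VS by rewrite memv_span// mem_head.
  apply/esym/eqP; rewrite eqEdim sub /= dimX; apply: maxn; apply/asboolP.
  by exists (v :: X) => // u; rewrite in_cons => /predU1P[->|/SX].
by apply/span_subvP => v /SX /SU'.
Qed.

(* The least subspace containing S. *)
Definition linear_hull (S : set V) : {vspace V} :=
  projT1 (linear_hull_subproof S).

Lemma linear_hullP (S : set V) :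
  (forall v, S v -> v \in linear_hull S) /\
  (forall U : {vspace V}, (forall v, S v -> v \in U) -> (linear_hull S <= U)%VS).
Proof. exact: projT2 (linear_hull_subproof S). Qed.

Definition plane_through (p q r : V) : set V :=
  [set y | exists s t : K, y = p + s *: (q - p) + t *: (r - p)].

End LinearHull.

Definition W (R : realType) : Type := 'rV[R]_4.

Section W_algebra.
Variable R : realType.

HB.instance Definition _ := Vector.on (W R).

Definition W_mk (a b c d : R) : W R := \row_(m < 4) [:: a; b; c; d]`_m.

Definition W1 (x : W R) : R := x ord0 (inord 0).
Definition Wi (x : W R) : R := x ord0 (inord 1).
Definition Wj (x : W R) : R := x ord0 (inord 2).
Definition Wk (x : W R) : R := x ord0 (inord 3).

Definition W_one : W R := W_mk 1 0 0 0.
Definition i_W : W R := W_mk 0 1 0 0.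
Definition j_W : W R := W_mk 0 0 1 0.
Definition k_W : W R := W_mk 0 0 0 1.

Definition W_mul (x y : W R) : W R :=
  (W1 x * W1 y - Wi x * Wk y - Wj x * Wj y - Wk x * Wi y) *: W_one +
  (W1 x * Wi y + Wi x * W1 y - Wj x * Wk y - Wk x * Wj y) *: i_W +
  (W1 x * Wj y + Wi x * Wi y + Wj x * W1 y - Wk x * Wk y) *: j_W +
  (W1 x * Wk y + Wi x * Wj y + Wj x * Wi y + Wk x * W1 y) *: k_W.

Lemma W_ext (x y : W R) : W1 x = W1 y -> Wi x = Wi y -> Wj x = Wj y ->
  Wk x = Wk y -> x = y.
Proof.
move=> e1 ei ej ek; apply/rowP => m; rewrite -[m]inord_val.
by case: m => -[|[|[|[|//]]]] /= _.
Qed.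

Lemma W1D x y : W1 (x + y) = W1 x + W1 y. Proof. by rewrite /W1 mxE. Qed.
Lemma WiD x y : Wi (x + y) = Wi x + Wi y. Proof. by rewrite /Wi mxE. Qed.
Lemma WjD x y : Wj (x + y) = Wj x + Wj y. Proof. by rewrite /Wj mxE. Qed.
Lemma WkD x y : Wk (x + y) = Wk x + Wk y. Proof. by rewrite /Wk mxE. Qed.
Lemma W1Z a x : W1 (a *: x) = a * W1 x. Proof. by rewrite /W1 mxE. Qed.
Lemma WiZ a x : Wi (a *: x) = a * Wi x. Proof. by rewrite /Wi mxE. Qed.
Lemma WjZ a x : Wj (a *: x) = a * Wj x. Proof. by rewrite /Wj mxE. Qed.
Lemma WkZ a x : Wk (a *: x) = a * Wk x. Proof. by rewrite /Wk mxE. Qed.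
Lemma W1_mk a b c d : W1 (W_mk a b c d) = a.
Proof. by rewrite /W1 mxE inordK. Qed.
Lemma Wi_mk a b c d : Wi (W_mk a b c d) = b.
Proof. by rewrite /Wi mxE inordK. Qed.
Lemma Wj_mk a b c d : Wj (W_mk a b c d) = c.
Proof. by rewrite /Wj mxE inordK. Qed.
Lemma Wk_mk a b c d : Wk (W_mk a b c d) = d.
Proof. by rewrite /Wk mxE inordK. Qed.

Definition WE := (W1D, WiD, WjD, WkD, W1Z, WiZ, WjZ, WkZ,
  W1_mk, Wi_mk, Wj_mk, Wk_mk).

Lemma W_mulA : associative W_mul.
Proof. by move=> x y z; apply: W_ext; rewrite !WE; ring. Qed.

Lemma W_mulC : commutative W_mul.
Proof. by move=> x y; apply: W_ext; rewrite !WE; ring. Qed.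

Lemma W_mul1x : left_id W_one W_mul.
Proof. by move=> x; apply: W_ext; rewrite !WE; ring. Qed.

Lemma W_mulDx : left_distributive W_mul +%R.
Proof. by move=> x y z; apply: W_ext; rewrite !WE; ring. Qed.

Lemma W_one_neq0 : W_one != 0.
Proof.
apply/eqP => /(congr1 W1); rewrite W1_mk /W1 mxE => /eqP.
by rewrite oner_eq0.
Qed.

HB.instance Definition _ := GRing.Zmodule_isComNzRing.Build (W R)
  W_mulA W_mulC W_mul1x W_mulDx W_one_neq0.

Lemma W_scaleAl (a : R) (x y : W R) : a *: (x * y) = (a *: x) * y.
Proof. by apply: W_ext; rewrite !WE; ring. Qed.

HB.instance Definition _ := GRing.Lmodule_isLalgebra.Build R (W R) W_scaleAl.
HB.instance Definition _ := GRing.Lalgebra_isComAlgebra.Build R (W R).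

Definition W_conj (x : W R) : W R :=
  W1 x *: 1 - Wk x *: i_W - Wj x *: j_W - Wi x *: k_W.

Definition theta : W R := i_W - k_W.

Definition Theta : W R := (Num.sqrt 2)^-1 *: theta.

Definition tri_norms : set (W R) := [set y | exists x, y = x * W_conj x].

(* The products x * W_conj x do not fill a plane: their first coordinate is a
   sum of squares, so they only fill the sector a *: 1 + b *: Theta with
   `|b| <= a.  The plane meant is the one they span. *)
Definition tri_plane : {vspace W R} := linear_hull tri_norms.

End W_algebra.

(* Hyp a b stands for a + b h. *)
Record hyp (R : realType) : Type := Hyp { hyp_re : R; hyp_im : R }.

Section hyp_algebra.
Variable R : realType.
Implicit Types z w : hyp R.

Definition pair_of_hyp z : R * R := (hyp_re z, hyp_im z).
Definition hyp_of_pair (p : R * R) : hyp R := Hyp p.1 p.2.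

Lemma pair_of_hypK : cancel pair_of_hyp hyp_of_pair.
Proof. by case. Qed.

HB.instance Definition _ := Choice.copy (hyp R) (can_type pair_of_hypK).

Definition hyp_add z w := Hyp (hyp_re z + hyp_re w) (hyp_im z + hyp_im w).
Definition hyp_opp z := Hyp (- hyp_re z) (- hyp_im z).
Definition hyp_scale (a : R) z := Hyp (a * hyp_re z) (a * hyp_im z).
Definition hyp_mul z w :=
  Hyp (hyp_re z * hyp_re w + hyp_im z * hyp_im w)
      (hyp_re z * hyp_im w + hyp_im z * hyp_re w).

Definition hyp_zero : hyp R := Hyp 0 0.
Definition hyp_one : hyp R := Hyp 1 0.
Definition hyp_h : hyp R := Hyp 0 1.

Lemma hyp_addA : associative hyp_add.
Proof. by move=> [a b] [c d] [e f]; congr Hyp => /=; ring. Qed.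

Lemma hyp_addC : commutative hyp_add.
Proof. by move=> [a b] [c d]; congr Hyp => /=; ring. Qed.

Lemma hyp_add0x : left_id hyp_zero hyp_add.
Proof. by move=> [a b]; congr Hyp => /=; ring. Qed.

Lemma hyp_addNx : left_inverse hyp_zero hyp_opp hyp_add.
Proof. by move=> [a b]; congr Hyp => /=; ring. Qed.

HB.instance Definition _ := GRing.isZmodule.Build (hyp R)
  hyp_addA hyp_addC hyp_add0x hyp_addNx.

Lemma hyp_scaleA a b z : hyp_scale a (hyp_scale b z) = hyp_scale (a * b) z.
Proof. by congr Hyp => /=; ring. Qed.

Lemma hyp_scale1 : left_id 1 hyp_scale.
Proof. by move=> [a b]; congr Hyp => /=; ring. Qed.

Lemma hyp_scaleDr : right_distributive hyp_scale +%R.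
Proof. by move=> a [b c] [d e]; congr Hyp => /=; ring. Qed.

Lemma hyp_scaleDl z : {morph hyp_scale^~ z : a b / a + b}.
Proof. by move=> a b; congr Hyp => /=; ring. Qed.

HB.instance Definition _ := GRing.Zmodule_isLmodule.Build R (hyp R)
  hyp_scaleA hyp_scale1 hyp_scaleDr hyp_scaleDl.

Lemma hyp_mulA : associative hyp_mul.
Proof. by move=> [a b] [c d] [e f]; congr Hyp => /=; ring. Qed.

Lemma hyp_mulC : commutative hyp_mul.
Proof. by move=> [a b] [c d]; congr Hyp => /=; ring. Qed.

Lemma hyp_mul1x : left_id hyp_one hyp_mul.
Proof. by move=> [a b]; congr Hyp => /=; ring. Qed.

Lemma hyp_mulDx : left_distributive hyp_mul +%R.
Proof. by move=> [a b] [c d] [e f]; congr Hyp => /=; ring. Qed.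

Lemma hyp_one_neq0 : hyp_one != 0.
Proof. by apply/eqP => -[] /eqP; rewrite oner_eq0. Qed.

HB.instance Definition _ := GRing.Zmodule_isComNzRing.Build (hyp R)
  hyp_mulA hyp_mulC hyp_mul1x hyp_mulDx hyp_one_neq0.

Lemma hyp_scaleAl (a : R) z w : a *: (z * w) = (a *: z) * w.
Proof. by congr Hyp => /=; ring. Qed.

HB.instance Definition _ :=
  GRing.Lmodule_isLalgebra.Build R (hyp R) hyp_scaleAl.
HB.instance Definition _ := GRing.Lalgebra_isComAlgebra.Build R (hyp R).

Lemma hyp_h2 : hyp_h * hyp_h = 1.
Proof. by congr Hyp => /=; ring. Qed.

End hyp_algebra.

(* Main.v *)
(* The i- and k-coordinates of x * W_conj x are opposite and its j-coordinate
   vanishes, so the products lie in the span of 1 and theta = sqrt 2 *: Theta;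
   since theta * theta = 2 *: 1, the map a + b h |-> a *: 1 + b *: Theta is
   multiplicative. *)
From HB Require Import structures.
Require Import Defs.
From mathcomp Require Import all_boot all_order all_algebra.
From mathcomp Require Import boolp classical_sets reals.
From mathcomp Require Import ring.

Set Implicit Arguments.
Unset Strict Implicit.
Unset Printing Implicit Defensive.

Import Order.TTheory GRing.Theory Num.Theory.
Local Open Scope classical_set_scope.
Local Open Scope ring_scope.

Section HyperbolicPlane.
Variable R : realType.
Implicit Types (x y : W R) (z w : hyp R).

Lemma W_oneE : 1 = W_one R.
Proof. by []. Qed.

Lemma W_mulE x y : x * y = W_mul x y.
Proof. by []. Qed.

Lemma theta_mk : theta R = W_mk 0 1 0 (- 1).
Proof. by apply: W_ext; rewrite /theta -scaleN1r !WE; ring. Qed.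

Lemma sqrt2_neq0 : Num.sqrt 2 != 0 :> R.
Proof. by rewrite gt_eqF// sqrtr_gt0 ltr0n. Qed.

Lemma sqrt2V_sqr : (Num.sqrt 2)^-1 * (Num.sqrt 2)^-1 * 2 = 1 :> R.
Proof. by rewrite -invfM -expr2 sqr_sqrtr ?ler0n// mulVf// pnatr_eq0. Qed.

Lemma theta_sqr : theta R * theta R = 2 *: 1.
Proof. by rewrite theta_mk W_mulE W_oneE; apply: W_ext; rewrite !WE; ring. Qed.

Lemma Theta_sqr : Theta R * Theta R = 1.
Proof.
by rewrite /Theta -scalerAl -scalerAr theta_sqr !scalerA sqrt2V_sqr scale1r.
Qed.

Lemma thetaE : theta R = Num.sqrt 2 *: Theta R.
Proof. by rewrite scalerA mulfV ?sqrt2_neq0// scale1r. Qed.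

Lemma mul_W_conj x : x * W_conj x =
  (W1 x ^+ 2 + Wi x ^+ 2 + Wj x ^+ 2 + Wk x ^+ 2) *: 1 +
  (W1 x * Wi x - W1 x * Wk x + Wi x * Wj x + Wj x * Wk x) *: theta R.
Proof.
(* Minus signs move into the scalars, so that [WE] meets only sums and scalings. *)
rewrite /W_conj theta_mk W_mulE W_oneE -!scaleNr.
by apply: W_ext; rewrite !WE; ring.
Qed.

Definition hyp_to_W z : W R := hyp_re z *: 1 + hyp_im z *: Theta R.

Lemma hyp_to_W_is_linear : linear hyp_to_W.
Proof.
by move=> a z w; rewrite /hyp_to_W !scalerDl scalerDr !scalerA addrACA.
Qed.

HB.instance Definition _ :=
  GRing.isLinear.Build R (hyp R) (W R) *:%R hyp_to_W hyp_to_W_is_linear.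

Lemma hyp_to_W1 : hyp_to_W 1 = 1.
Proof. by rewrite /hyp_to_W scale1r scale0r addr0. Qed.

Lemma hyp_to_W_h : hyp_to_W (hyp_h R) = Theta R.
Proof. by rewrite /hyp_to_W scale1r scale0r add0r. Qed.

Lemma hyp_to_WM z w : hyp_to_W (z * w) = hyp_to_W z * hyp_to_W w.
Proof.
(* Only [T * T = 1] is needed; abstracting [Theta] keeps [scalerA] from merging with the scalar
   inside its definition. *)
rewrite /hyp_to_W; move: (Theta R) Theta_sqr => T TT.
rewrite mulrDl !mulrDr -!scalerAl -!scalerAr TT !mul1r mulr1 !scalerA !scalerDl.
by rewrite -!addrA; congr (_ + _); rewrite addrC addrA.
Qed.

(** The factor [Num.sqrt 2] cancels the i-coordinate of [Theta], its inverse. Defined on all of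
    [W R], this inverts [hyp_to_W] only on the plane. *)
Definition W_to_hyp x : hyp R := Hyp (W1 x) (Num.sqrt 2 * Wi x).

Lemma hyp_to_WK : cancel hyp_to_W W_to_hyp.
Proof.
move=> [a b]; rewrite /hyp_to_W /Theta theta_mk W_oneE /W_to_hyp !WE /=.
by congr Hyp; field; exact: sqrt2_neq0.
Qed.

Lemma tri_planeE : tri_plane R = <<[:: 1; Theta R]>>%VS.
Proof.
have [sub least] := linear_hullP (@tri_norms R).
(* [1] is its own conjugate, hence itself one of the products. *)
have plane1 : 1 \in tri_plane R.
  apply: sub; exists 1; rewrite mul_W_conj W_oneE !WE.
  by rewrite !(expr0n, expr1n, mulr0, mul0r, addr0, subr0) scale1r scale0r addr0.
apply/eqP; rewrite eqEsubv; apply/andP; split.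
  apply: least => _ [x ->]; rewrite mul_W_conj thetaE.
  have T_span : Theta R \in <<[:: 1; Theta R]>>%VS.
    by rewrite memv_span// in_cons mem_head orbT.
  apply: memvD; last by do 2!apply: memvZ.
  by apply: memvZ; rewrite memv_span// mem_head.
(* The generator [1] is [plane1]; [Theta] is a multiple of [theta], so [theta] remains to be
   reached. *)
apply/span_subvP => v; rewrite !inE => /orP[] /eqP -> //; apply: memvZ.
(* theta is recovered from x * W_conj x = 2 *: 1 + theta at x = 1 + i_W. *)
have : W_mk 1 1 0 0 * W_conj (W_mk 1 1 0 0) \in tri_plane R.
  by apply: sub; eexists.
rewrite mul_W_conj !WE !(expr0n, expr1n, mulr0, mul0r, addr0, subr0) mulr1.
by rewrite scale1r rpredDl ?memvZ.
Qed.

(** Identifies the plane with the image of [hyp_to_W]: this yields both closure under products and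
    surjectivity of the isomorphism. *)
Lemma mem_tri_planeP y :
  reflect (exists z, y = hyp_to_W z) (y \in tri_plane R).
Proof.
rewrite tri_planeE span_cons span_seq1; apply: (iffP memv_addP).
  by move=> [_ /vlineP[a ->]] [_ /vlineP[b ->]] ->; exists (Hyp a b).
move=> [z ->]; exists (hyp_re z *: 1); first by rewrite memvZ// memv_line.
by exists (hyp_im z *: Theta R); rewrite // memvZ// memv_line.
Qed.

Lemma dim_tri_plane : \dim (tri_plane R) = 2%N.
Proof.
rewrite tri_planeE; apply/eqP; rewrite -[2%N]/(size [:: 1; Theta R]).
have zero_in b : hyp_to_W (Hyp 0 b) = b *: Theta R.
  by rewrite /hyp_to_W scale0r add0r.
(* The dimension equals the number of generators exactly when they are free. Injectivity of
   [hyp_to_W] turns either possible dependence into [1 = 0] in [R]. *)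
rewrite -[_ == _]/(free _) free_cons span_seq1 seq1_free; apply/andP; split.
  apply/negP => /vlineP[b]; rewrite -zero_in -hyp_to_W1 => /(can_inj hyp_to_WK)[] /eqP.
  by rewrite oner_eq0.
rewrite -hyp_to_W_h -(raddf0 hyp_to_W); apply/eqP => /(can_inj hyp_to_WK)[] /eqP.
by rewrite oner_eq0.
Qed.

End HyperbolicPlane.

Theorem theorem6 (R : realType) :
  [/\ \dim (tri_plane R) = 2%N,
      [set y : W R | y \in tri_plane R] = plane_through (0 : W R) (1 : W R) (Theta R) &
      exists (box : subvs_of (tri_plane R) -> subvs_of (tri_plane R) ->
                    subvs_of (tri_plane R))
             (e t : subvs_of (tri_plane R)),
        [/\ forall u v, vsval (box u v) = vsval u * vsval v,
            vsval e = 1 /\ vsval t = Theta R,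
            [/\ box e e = e, box e t = t, box t e = t & box t t = e] &
            exists phi : {linear hyp R -> subvs_of (tri_plane R)},
              [/\ bijective phi,
                  forall z w, phi (z * w) = box (phi z) (phi w),
                  phi 1 = e &
                  phi (hyp_h R) = t]]].
Proof.
have mem z : hyp_to_W z \in tri_plane R by apply/mem_tri_planeP; exists z.
have memM (u v : subvs_of (tri_plane R)) : vsval u * vsval v \in tri_plane R.
  have /mem_tri_planeP[z ->] := subvsP u; have /mem_tri_planeP[w ->] := subvsP v.
  by rewrite -hyp_to_WM.
split; first exact: dim_tri_plane.
  apply/seteqP; split=> y /=.
    by move=> /mem_tri_planeP[z ->]; exists (hyp_re z), (hyp_im z);
      rewrite add0r !subr0.
  move=> [a [b ->]]; rewrite add0r !subr0; exact: (mem (Hyp a b)).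
pose phi : {linear hyp R -> subvs_of (tri_plane R)} :=
  vsproj (tri_plane R) \o @hyp_to_W R.
have phiK z : vsval (phi z) = hyp_to_W z by rewrite /= vsprojK.
(* By [memM] the product already lies in the plane, where [vsproj] changes nothing, so this is a
   true restriction. *)
pose box (u v : subvs_of (tri_plane R)) := vsproj (tri_plane R) (vsval u * vsval v).
have boxE u v : vsval (box u v) = vsval u * vsval v by rewrite vsprojK.
have phiM z w : phi (z * w) = box (phi z) (phi w).
  by apply: val_inj; rewrite /= -/(vsval _) boxE !phiK hyp_to_WM.
exists box, (phi 1), (phi (hyp_h R)); split=> //.
- by rewrite !phiK hyp_to_W1 hyp_to_W_h.
(* The table is the image under [phi] of the products of [1] and [hyp_h]. *)
- by rewrite -!phiM !mul1r mulr1 hyp_h2.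
exists phi; split=> //; exists (@W_to_hyp R \o vsval) => [z|u].
  by rewrite /= phiK hyp_to_WK.
apply: val_inj; rewrite /= -/(vsval _) phiK.
(* Every point of the plane is some [hyp_to_W z], so the left inverse is also a right inverse
   there. *)
by have /mem_tri_planeP[z ->] := subvsP u; rewrite hyp_to_WK.
Qed.
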